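(* Let $q$ be an odd prime and $t>1$ an integer, and let $K/\mathbb{Q}$ be a Galois extension of degree $q^t$. Write the class number as $h_K = p_1^{e_1}\cdots p_u^{e_u}$ with distinct primes $p_i$. If $q$ does not divide $|\mathrm{Aut}(C\ell(K))|$ and $q$ is relatively prime to $h_K$, then $q \in \mathbf{R}_{K/\mathbb{Q}}$.
   Context: $C\ell(K)$ is the ideal class group of $K$, $h_K$ its order. The residue degree of a prime $\mathfrak{P}$ of $K$ over $\mathbb{Q}$ is $[\mathcal{O}_K/\mathfrak{P}:\mathbb{Z}/p\mathbb{Z}]$ where $p\mathbb{Z}=\mathfrak{P}\cap\mathbb{Z}$. Convention: all prime ideals considered are unramified. $\mathbf{R}_{K/\mathbb{Q}}$ is the set of positive integers $f$ such that $C\ell(K)$ is generated by the ideal classes of (unramified) prime ideals of $K$ of residue degree $f$ over $\mathbb{Q}$. *)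

(* Defs.v *)
From HB Require Import structures.
From mathcomp Require Import all_boot all_order all_algebra all_field.
From mathcomp Require Import finmap.
From mathcomp Require Import boolp classical_sets functions cardinality.

Set Implicit Arguments.
Unset Strict Implicit.
Unset Printing Implicit Defensive.

Import GRing.Theory.
Local Open Scope classical_set_scope.
Local Open Scope ring_scope.
Local Open Scope quotient_scope.

Section RingOfIntegers.
Variable K : fieldExtType rat.

Definition algint : {pred K} := fun x => `[< integralOver (intr : int -> K) x >].

Fact algint_subring_closed : subring_closed algint.
Proof.
split.
- by apply/asboolP; apply: integral1.
- by move=> x y /asboolP hx /asboolP hy; apply/asboolP; apply: integral_sub.
- by move=> x y /asboolP hx /asboolP hy; apply/asboolP; apply: integral_mul.
Qed.

HB.instance Definition _ :=
  GRing.isSubringClosed.Build K algint algint_subring_closed.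

Record ring_of_integers : predArgType :=
  AlgInt { algint_val :> K; _ : algint_val \in algint }.

HB.instance Definition _ := [isSub for algint_val].
HB.instance Definition _ := [Choice of ring_of_integers by <:].
HB.instance Definition _ :=
  [SubChoice_isSubComNzRing of ring_of_integers by <:].

Lemma ring_of_integers_mulf_neq0 (a b : ring_of_integers) :
  a != 0 -> b != 0 -> a * b != 0.
Proof.
move=> a0 b0; apply/eqP => ab0.
have /eqP : val (a * b) = 0 by rewrite ab0 rmorph0.
rewrite rmorphM mulf_eq0 => /orP[] /eqP h.
- by move/eqP: a0; apply; apply: val_inj; rewrite h rmorph0.
- by move/eqP: b0; apply; apply: val_inj; rewrite h rmorph0.
Qed.

End RingOfIntegers.

Section NonzeroIdeals.
Variable K : fieldExtType rat.
Local Notation O := (ring_of_integers K).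

Record nzideal := NZIdeal {
  nzideal_set :> set O;
  nzideal0 : nzideal_set 0;
  nzidealD : forall x y, nzideal_set x -> nzideal_set y -> nzideal_set (x + y);
  nzidealM : forall a x, nzideal_set x -> nzideal_set (a * x);
  nzideal_neq0 : exists2 x, nzideal_set x & x != 0 }.

HB.instance Definition _ := gen_eqMixin nzideal.
HB.instance Definition _ := gen_choiceMixin nzideal.

Lemma nzideal_inj (I J : nzideal) : I = J :> set O -> I = J.
Proof.
case: I J => I I1 I2 I3 I4 [J J1 J2 J3 J4] /= IJ; subst J.
by congr NZIdeal; apply: Prop_irrelevance.
Qed.

Definition nzideal_unit : nzideal.
Proof.
refine (@NZIdeal setT _ _ _ _) => //.
by exists 1 => //; apply: oner_neq0.
Defined.

Definition prod_set (I J : set O) : set O :=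
  [set x | exists2 s : seq (O * O),
     (forall u, u \in s -> I u.1 /\ J u.2) & x = \sum_(u <- s) u.1 * u.2].

Lemma prod_setM (I J : set O) x y : I x -> J y -> prod_set I J (x * y).
Proof.
move=> Ix Jy; exists [:: (x, y)]; last by rewrite big_seq1.
by move=> u; rewrite inE => /eqP ->.
Qed.

Definition nzideal_mul (I J : nzideal) : nzideal.
Proof.
refine (@NZIdeal (prod_set I J) _ _ _ _).
- by exists [::] => //; rewrite big_nil.
- move=> x y [s hs ->] [r hr ->]; exists (s ++ r); last by rewrite big_cat.
  by move=> u; rewrite mem_cat => /orP[/hs|/hr].
- move=> a x [s hs ->]; exists [seq (a * u.1, u.2) | u <- s].
    by move=> _ /mapP[u /hs[Iu Ju] ->]; split=> //=; apply: nzidealM.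
  by rewrite big_map mulr_sumr; apply: eq_bigr => u _ /=; rewrite mulrA.
- have [x Ix x0] := nzideal_neq0 I; have [y Jy y0] := nzideal_neq0 J.
  exists (x * y); first exact: prod_setM.
  exact: ring_of_integers_mulf_neq0.
Defined.

Lemma nzideal_sum (I : nzideal) (T : eqType) (s : seq T) (F : T -> O) :
  (forall u, u \in s -> nzideal_set I (F u)) -> nzideal_set I (\sum_(u <- s) F u).
Proof.
move=> h; rewrite big_seq; apply: (big_ind (nzideal_set I)) => //.
- exact: nzideal0.
- exact: nzidealD.
Qed.

Lemma prod_set_sub (I J : set O) (L : nzideal) :
  (forall x y, I x -> J y -> nzideal_set L (x * y)) -> prod_set I J `<=` L.
Proof. by move=> h _ [s hs ->]; apply: nzideal_sum => u /hs[]; apply: h. Qed.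

Lemma nzideal_mulC : commutative nzideal_mul.
Proof.
by move=> I J; apply: nzideal_inj; apply/seteqP; split;
  apply: (@prod_set_sub _ _ (nzideal_mul _ _)) => x y Ix Jy;
  rewrite mulrC; apply: prod_setM.
Qed.

Lemma nzideal_mul1 : left_id nzideal_unit nzideal_mul.
Proof.
move=> I; apply: nzideal_inj; apply/seteqP; split.
  by apply: prod_set_sub => x y _; apply: nzidealM.
by move=> x Ix; rewrite -[x]mul1r; apply: prod_setM.
Qed.

Lemma nzideal_mulA_sub (I J L : nzideal) :
  nzideal_mul I (nzideal_mul J L) `<=` nzideal_mul (nzideal_mul I J) L.
Proof.
apply: prod_set_sub => x _ Ix [s hs ->]; rewrite mulr_sumr.
apply: nzideal_sum => u /hs[Ju Lu]; rewrite mulrA.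
by apply: prod_setM => //; apply: prod_setM.
Qed.

Lemma nzideal_mulA : associative nzideal_mul.
Proof.
move=> I J L; apply: nzideal_inj; apply/seteqP; split.
  exact: nzideal_mulA_sub.
rewrite (nzideal_mulC (nzideal_mul I J)) (nzideal_mulC I (nzideal_mul J L)).
by rewrite (nzideal_mulC I J) (nzideal_mulC J L); apply: nzideal_mulA_sub.
Qed.

Lemma nzideal_mulr1 : right_id nzideal_unit nzideal_mul.
Proof. by move=> I; rewrite nzideal_mulC nzideal_mul1. Qed.

HB.instance Definition _ := isMonoid.Build nzideal
  nzideal_mulA nzideal_mul1 nzideal_mulr1.

(* I ~ J iff (a)I = (b)J for some nonzero a and b. *)
Definition nzideal_equiv (I J : nzideal) : bool :=
  `[< exists a b : O, [/\ a != 0, b != 0 &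
        [set a * x | x in (I : set O)] = [set b * x | x in (J : set O)]] >].

Fact nzideal_equiv_class : equiv_class_of nzideal_equiv.
Proof.
have imM (a b : O) (A : set O) :
    [set a * x | x in [set b * x | x in A]] = [set a * b * x | x in A].
  by rewrite image_comp; congr image; apply/funext => x /=; rewrite mulrA.
have sub I J : nzideal_equiv I J -> nzideal_equiv J I.
  move=> /asboolP[a [b [a0 b0 h]]]; apply/asboolP.
  by exists b, a; split.
split=> [I|I J|J I L].
- by apply/asboolP; exists 1, 1; split=> //; apply: oner_neq0.
- by apply/idP/idP; apply: sub.
- move=> /asboolP[a [b [a0 b0 h]]] /asboolP[c [d [c0 d0 h']]]; apply/asboolP.
  exists (c * a), (b * d); split; [exact: ring_of_integers_mulf_neq0..|].
  by rewrite -imM h imM (mulrC c) -!imM h'.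
Qed.

Canonical nzideal_equivRel := EquivRelPack nzideal_equiv_class.

Lemma nzideal_equivP (I J : nzideal) :
  reflect (exists a b : O, [/\ a != 0, b != 0 &
    [set a * x | x in (I : set O)] = [set b * x | x in (J : set O)]])
    (nzideal_equiv I J).
Proof. exact: asboolP. Qed.

Lemma nzideal_equiv_mul (I I' J : nzideal) :
  nzideal_equiv I I' -> nzideal_equiv (nzideal_mul I J) (nzideal_mul I' J).
Proof.
have sub (A B C : nzideal) (a b : O) :
    [set a * x | x in (A : set O)] `<=` [set b * x | x in (B : set O)] ->
    [set a * x | x in (nzideal_mul A C : set O)] `<=`
    [set b * x | x in (nzideal_mul B C : set O)].
  move=> AB _ [_ [s hs ->] <-]; elim: s hs => [|u s IHs] hs.
    by exists 0; [apply: nzideal0 | rewrite big_nil !mulr0].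
  have [|z Bz hz] := IHs; first by move=> v vs; apply: hs; rewrite inE vs orbT.
  have [Au Cu] := hs u (mem_head _ _).
  have [y By hy] : [set b * x | x in (B : set O)] (a * u.1).
    by apply: AB; exists u.1.
  exists (y * u.2 + z).
    by apply: nzidealD => //; apply: prod_setM.
  by rewrite big_cons !mulrDr !mulrA hy -hz.
move=> /nzideal_equivP[a [b [a0 b0 /seteqP[h1 h2]]]].
by apply/nzideal_equivP; exists a, b; split=> //; apply/seteqP; split; apply: sub.
Qed.

End NonzeroIdeals.

Section ClassGroup.
Variable K : fieldExtType rat.

Definition class_group := {eq_quot (nzideal_equivRel K)}.
HB.instance Definition _ : EqQuotient (nzideal K) (nzideal_equivRel K) class_group :=
  EqQuotient.on class_group.
HB.instance Definition _ := Choice.on class_group.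

Definition ideal_class (I : nzideal K) : class_group := \pi_class_group I.

Definition class_one : class_group := ideal_class 1%g.
Definition class_mul (c d : class_group) : class_group :=
  ideal_class (repr c * repr d)%g.

Lemma ideal_classP (I J : nzideal K) :
  ideal_class I = ideal_class J <-> nzideal_equiv I J.
Proof. by rewrite /ideal_class; split => [/eqmodP|h]; last exact/eqmodP. Qed.

Lemma ideal_class_repr (c : class_group) : ideal_class (repr c) = c.
Proof. exact: reprK. Qed.

Lemma ideal_classM (I J : nzideal K) :
  ideal_class (I * J)%g = class_mul (ideal_class I) (ideal_class J).
Proof.
have hr L : nzideal_equiv L (repr (ideal_class L)).
  by apply/ideal_classP; rewrite ideal_class_repr.
rewrite /class_mul; transitivity (ideal_class (repr (ideal_class I) * J)%g).
  by apply/ideal_classP; apply: nzideal_equiv_mul.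
have mulC : commutative (fun A B : nzideal K => A * B)%g := @nzideal_mulC K.
rewrite ![(repr (ideal_class I) * _)%g]mulC.
by apply/ideal_classP; apply: nzideal_equiv_mul.
Qed.

Fact class_mulA : associative class_mul.
Proof.
move=> c d e; rewrite -(ideal_class_repr c) -(ideal_class_repr d).
by rewrite -(ideal_class_repr e) -!ideal_classM mulgA.
Qed.

Fact class_mul1 : left_id class_one class_mul.
Proof.
by move=> c; rewrite -(ideal_class_repr c) -ideal_classM mul1g.
Qed.

Fact class_mulr1 : right_id class_one class_mul.
Proof.
by move=> c; rewrite -(ideal_class_repr c) -ideal_classM mulg1.
Qed.

HB.instance Definition _ := isMonoid.Build class_group
  class_mulA class_mul1 class_mulr1.

(* fset_set sends an infinite set to fset0, so both cardinals below are 0 on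
   infinite sets; in particular class_number K > 0 says that Cl(K) is finite. *)
Definition class_number : nat := #|` fset_set [set: class_group]|%fset.

Definition class_automorphisms : set (class_group -> class_group) :=
  [set s : class_group -> class_group | bijective s /\ {morph s : c d / (c * d)%g}].

Definition card_class_automorphisms : nat :=
  #|` fset_set class_automorphisms|%fset.

(* The library monoid structure carries no inversion, so closure of a subgroup
   under inverses is expressed by the equation c * d = 1. *)
Definition is_class_subgroup (H : set class_group) : Prop :=
  [/\ H 1%g, (forall c d, H c -> H d -> H (c * d)%g) &
      forall c d, H c -> (c * d = 1)%g -> H d].

Definition generates_class_group (S : set class_group) : Prop :=
  forall H, is_class_subgroup H -> S `<=` H -> H = setT.

End ClassGroup.

Section PrimeIdeals.
Variable K : fieldExtType rat.
Local Notation O := (ring_of_integers K).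

Definition lies_over (P : prime_idealr O) (p : nat) : Prop :=
  prime p /\ forall z : int, (z%:~R \in (P : {pred O})) <-> (p%:Z %| z)%Z.

Lemma lies_over_pchar (P : prime_idealr O) p :
  lies_over P p -> p \in [pchar {ideal_quot P}].
Proof.
case=> p_pr hP; rewrite inE p_pr /=.
have : (p%:R : O) \in (P : {pred O}) by apply/(hP p%:Z)/dvdzz.
rewrite -[X in X \in _]subr0 Quotient.idealrBE => /eqP.
by rewrite pi_zeror rmorph_nat => ->.
Qed.

(* [O/P : F_p] = f, where O/P carries the library's F_p-vector space structure
   on rings of characteristic p. *)
Definition has_residue_degree (P : prime_idealr O) (f : nat) : Prop :=
  exists (p : nat) (Pp : lies_over P p),
    inhabited (Vector.axiom f (pPrimeCharType (lies_over_pchar Pp))).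

Definition pow_divides (I : nzideal K) (k n : nat) : Prop :=
  exists J : nzideal K, (I ^+ k * J)%g = [set n%:R * x | x in setT] :> set O.

Definition has_ramification_index (P : prime_idealr O) (I : nzideal K) (e : nat)
    : Prop :=
  exists p, [/\ lies_over P p, pow_divides I e p & ~ pow_divides I e.+1 p].

(* The library's prime ideals may be zero; requiring P to be the underlying set
   of some I : nzideal K both excludes this and provides the ideal class. *)
Definition unramified_prime_classes (f : nat) : set (class_group K) :=
  [set c | exists (P : prime_idealr O) (I : nzideal K),
     [/\ (forall x, nzideal_set I x <-> x \in (P : {pred O})), has_ramification_index P I 1,
         has_residue_degree P f & c = ideal_class I]].

Definition generating_residue_degrees : set nat :=
  [set f | (0 < f)%N /\ generates_class_group (unramified_prime_classes f)].

End PrimeIdeals.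

(* Main.v *)
(* The hypotheses force Cl(K) to be trivial, so that any residue degree will do.
   An element g of the Galois group acts on the finite set Aut(Cl(K)) by
   s |-> g o s, a map of q-power order; as q does not divide |Aut(Cl(K))| this
   has a fixed point, so g acts trivially on Cl(K).  For an ideal I the product
   of the g(I) is principal: by Kronecker's content argument, if f has
   coefficients in I then the product of the conjugates of f is in Z[X], its
   content z lies in the product ideal, and by the Dedekind-Prague theorem z
   divides every product of conjugates of coefficients of f.  So each class c
   satisfies c ^ (q ^ t) = 1, and multiplication by c, a map of q-power order on
   the set Cl(K) whose cardinal is prime to q, has a fixed point: c = 1. *)
From HB Require Import structures.
Require Import Defs.
From mathcomp Require Import all_boot all_order all_algebra all_fingroup.
From mathcomp Require Import all_solvable all_field.
From mathcomp Require Import finmap boolp classical_sets cardinality.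

Set Implicit Arguments.
Unset Strict Implicit.
Unset Printing Implicit Defensive.

Import GRing.Theory Num.Theory.
Local Open Scope ring_scope.

(** * Splitting a polynomial over an extension field *)

Lemma exists_irreducible_factor (F : fieldType) (p : {poly F}) :
  (1 < size p)%N -> exists2 r, irreducible_poly r & r %| p.
Proof.
elim/ltn_ind: {p}(size p) {-2}p (erefl (size p)) => n IH p sp p_gt1.
have [irr_p|red_p] := pselect (irreducible_poly p); first by exists p.
have [d [sd dp ndp]] :
    exists d : {poly F}, [/\ size d != 1%N, d %| p & ~~ (d %= p)].
  apply: contrapT => h; apply: red_p; split=> // d sd dp.
  apply: contrapT => /negP ndp; apply: h; by exists d.
have p0 : p != 0 by rewrite -size_poly_gt0 (ltn_trans _ p_gt1).
have ltd : (size d < n)%N.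
  by rewrite -sp ltn_neqAle dvdp_leq // andbT (dvdp_size_eqp dp).
have d_gt1 : (1 < size d)%N.
  by rewrite ltn_neqAle eq_sym sd size_poly_gt0 (dvdpN0 dp p0).
have [r irr_r rd] := IH _ ltd d erefl d_gt1.
by exists r => //; apply: dvdp_trans dp.
Qed.

(** Induction on the size over all fields at once: a root of an irreducible factor is adjoined, and
    the quotient by the resulting linear factor is split over the larger field. *)
Lemma exists_splitting (F : fieldType) (p : {poly F}) :
  exists (E : fieldType) (i : {rmorphism F -> E}) (rs : seq E),
    map_poly i p = i (lead_coef p) *: \prod_(z <- rs) ('X - z%:P).
Proof.
move: (leqnn (size p)); move: {2}(size p) => n.
elim: n => [|n IH] in F p *; rewrite ?leqn0 => sp.
  exists F, idfun, [::]; move: sp; rewrite size_poly_eq0 => /eqP ->.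
  by rewrite lead_coef0 rmorph0 /= scale0r.
have [p_gt1|] := ltnP 1 (size p); last first.
  move=> /size1_polyC ->; exists F, idfun, [::].
  by rewrite big_nil lead_coefC /= map_polyC /= alg_polyC.
have [r irr_r rp] := exists_irreducible_factor p_gt1.
have [L [j [z rz]]] : exists (L : fieldType) (j : {rmorphism F -> L}) z,
    root (map_poly j r) z.
  by have [L _ [z rz _]] := irredp_FAdjoin irr_r; exists L, (in_alg L), z.
have jpz : root (map_poly j p) z.
  by apply: (root_dvdp _ rz); rewrite dvdp_map.
have /factor_theorem[s Ds] := jpz.
have s0 : s != 0.
  apply: contraTneq p_gt1 => s0; move/eqP: Ds; rewrite s0 mul0r.
  by rewrite map_poly_eq0 => /eqP ->; rewrite size_poly0.
have ss : (size s <= n)%N.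
  move: sp; rewrite -(size_map_poly j) Ds size_Mmonic ?monicXsubC //.
  by rewrite size_XsubC addn2.
have [E [i [rs Drs]]] := IH L s ss.
exists E, (i \o j : {rmorphism F -> E}), (rcons rs (i z)).
rewrite (map_poly_comp i j) Ds rmorphM /= Drs -cats1 big_cat big_seq1 /=.
rewrite map_polyXsubC scalerAl; congr (_ *: _ * _).
by rewrite /= -(lead_coef_map j) Ds lead_coefM lead_coefXsubC mulr1.
Qed.

(** * Integrality of products of coefficients *)

Section Integral.
Variable F : fieldType.
Local Notation integral := (integralOver (intr : int -> F)).

Lemma integral_lead_root (p : {poly F}) (z : F) :
  (1 < size p)%N -> (forall i, integral p`_i) -> root p z ->
  integral (lead_coef p * z).
Proof.
move=> p_gt1 pint pz0.
case sp: (size p) p_gt1 => [//|[//|n]] _.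
pose c := lead_coef p.
have Dc : p`_n.+1 = c by rewrite /c lead_coefE sp.
(* 'X^(n.+1) + r is c ^ n * p(X / c). *)
pose r := \poly_(i < n.+1) (p`_i * c ^+ (n - i)).
have sr : (size r < size ('X^(n.+1) : {poly F}))%N.
  by rewrite size_polyXn ltnS size_poly.
have int_exp x k : integral x -> integral (x ^+ k).
  move=> hx; elim: k => [|k IH]; first exact: integral1.
  by rewrite exprS; apply: integral_mul.
apply: (@integral_root_monic _ _ _ _ ('X^(n.+1) + r)).
- by rewrite monicE lead_coefDl // lead_coefXn.
- have : c ^+ n * p.[z] = 0 by rewrite (rootP pz0) mulr0.
  rewrite /root hornerD hornerXn horner_poly horner_coef sp.
  rewrite big_ord_recr /= Dc => h.
  apply/eqP; rewrite -[RHS]h mulrDr addrC; congr (_ + _).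
    rewrite mulr_sumr; apply: eq_bigr => i _; rewrite exprMn.
    rewrite [RHS]mulrCA -!mulrA; congr (_ * _).
    by rewrite mulrA -exprD subnK // -ltnS.
  by rewrite exprMn mulrA -exprSr.
- apply/integral_poly => i; rewrite coefD coefXn coef_poly.
  apply: integral_add; first exact: integral_nat.
  case: ifP => _; last exact: integral0.
  by apply: integral_mul => //; apply/int_exp/pint.
Qed.

(** For nonzero [p], the leading coefficient [c] is integral, and so is [c * z] by the previous
    lemma. Hence subtracting [c *: 'X^k] from [p] keeps the hypothesis and lowers the size. *)
Lemma integral_divXsubC (p : {poly F}) (z : F) :
  (forall i, integral (p * ('X - z%:P))`_i) -> forall i, integral p`_i.
Proof.
move: (leqnn (size p)); move: {2}(size p) => n.
elim: n => [|n IH] in p *.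
  rewrite leqn0 size_poly_eq0 => /eqP -> _ i.
  by rewrite coef0; exact: integral0.
move=> sp pint; have [->|p0] := eqVneq p 0.
  move=> i; rewrite coef0; exact: integral0.
set c := lead_coef p.
have lc : lead_coef (p * ('X - z%:P)) = c.
  by rewrite lead_coefM lead_coefXsubC mulr1.
have cint : integral c by rewrite -lc lead_coefE.
have czint : integral (c * z).
  rewrite -lc; apply: integral_lead_root => //; last first.
    by rewrite rootM root_XsubC eqxx orbT.
  by rewrite size_Mmonic ?monicXsubC // size_XsubC addn2 /= ltnS size_poly_gt0.
set k := (size p).-1.
have h : forall i, integral (p - c *: 'X^k)`_i.
  apply: IH => [|i].
    apply/leq_sizeP => j; rewrite coefB coefZ coefXn leq_eqVlt.
    have sk : size p = k.+1 by rewrite prednK // size_poly_gt0.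
    have [->|] := eqVneq j k; first by rewrite mulr1 /c lead_coefE subrr.
    move=> jk; rewrite mulr0 subr0 => nj; apply: nth_default.
    rewrite sk ltn_neqAle eq_sym jk /=.
    case/orP: nj => [/eqP <-|]; first by rewrite -ltnS -sk.
    by move=> nj; rewrite -ltnS -sk (leq_trans sp) // ltnW.
  rewrite mulrBl coefB; apply: integral_sub => //.
  rewrite -scalerAl mulrBr -exprSr coefZ coefB coefXn coefMC coefXn mulrBr.
  apply: integral_sub; first by apply: integral_mul => //; exact: integral_nat.
  by rewrite mulrCA; apply: integral_mul => //; exact: integral_nat.
move=> i; rewrite -[p](subrK (c *: 'X^k)) coefD; apply: integral_add => //.
by rewrite coefZ coefXn; apply: integral_mul => //; exact: integral_nat.
Qed.

(** Induction on [rs] with [g] varying. The previous lemma strips off ['X - z%:P]; a coefficient of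
    [('X - z%:P) * r] is a coefficient of [r] minus [z] times the next one, and this [z] is moved
    onto [g], since [r * (z *: g)] has integral coefficients too. *)
Lemma integral_coef_prod_XsubC (rs : seq F) (g : {poly F}) :
  (forall j, integral (\prod_(z <- rs) ('X - z%:P) * g)`_j) ->
  forall i j, integral ((\prod_(z <- rs) ('X - z%:P))`_i * g`_j).
Proof.
elim: rs g => [|z rs IH] g.
  rewrite big_nil mul1r => gint i j; rewrite coef1.
  by apply: integral_mul => //; exact: integral_nat.
rewrite big_cons; set r := \prod_(_ <- _) _ => rgint.
have h1 : forall j, integral (r * g)`_j.
  apply: (@integral_divXsubC _ z) => j; rewrite mulrC mulrA; exact: rgint.
have h2 : forall j, integral (r * (z *: g))`_j.
  move=> j; rewrite -scalerAr.
  have -> : (z *: (r * g))`_j =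
      ('X * (r * g))`_j - (('X - z%:P) * (r * g))`_j.
    by rewrite mulrBl coefB coefCM coefZ opprB addrC subrK.
  apply: integral_sub; last by rewrite mulrA.
  by rewrite coefXM; case: ifP => // _; exact: integral0.
move=> i j; rewrite mulrBl coefB coefXM coefCM mulrBl.
apply: integral_sub.
  by case: ifP => _; [rewrite mul0r; exact: integral0 | exact: IH].
by rewrite (mulrC z) -mulrA -coefZ; exact: IH.
Qed.

End Integral.

Lemma integralOver_inj (F E : fieldType) (i : {rmorphism F -> E}) (x : F) :
  integralOver (intr : int -> E) (i x) <-> integralOver (intr : int -> F) x.
Proof.
split=> [[p mp pr]|/(integral_rmorph i)].
  exists p => //; move: pr; rewrite -(fmorph_root i) -map_poly_comp.
  by congr (root _ _); apply: eq_map_poly => z /=; rewrite rmorph_int.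
case=> p mp pr; exists p => //; move: pr; congr (root _ _).
by apply: eq_map_poly => z /=; rewrite rmorph_int.
Qed.

(* Dedekind's Prague theorem; only one factor needs to be split. *)
Lemma integral_coefM (F : fieldType) (f g : {poly F}) :
  (forall k, integralOver (intr : int -> F) (f * g)`_k) ->
  forall i j, integralOver (intr : int -> F) (f`_i * g`_j).
Proof.
move=> fgint i j; have [E [h [rs Drs]]] := exists_splitting f.
(* The leading coefficient of [f] goes to the second factor, so that the first becomes a product of
   monic linear factors. *)
pose g' := h (lead_coef f) *: map_poly h g.
apply/(integralOver_inj h); rewrite rmorphM -!coef_map /= Drs coefZ.
rewrite mulrAC mulrC -coefZ -/g'.
apply: integral_coef_prod_XsubC => k.
rewrite -scalerAr scalerAl -Drs -rmorphM coef_map.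
by apply/(integralOver_inj h).
Qed.

(** Iterated Prague theorem: [x] picks one coefficient index per factor, and the scalar [c], not
    assumed integral, collects the coefficients already picked. *)
Lemma integral_coef_prod (F : fieldType) (I : Type) (s : seq I)
    (f : I -> {poly F}) (x : seq nat) (c : F) :
  size x = size s ->
  (forall k, integralOver (intr : int -> F) (c *: \prod_(i <- s) f i)`_k) ->
  integralOver (intr : int -> F) (c * \prod_(u <- zip s x) (f u.1)`_u.2).
Proof.
elim: s x c => [|i s IH] [|k x] c //=.
  move=> _ /(_ 0%N); by rewrite !big_nil coefZ coef1.
move=> [sx] h; rewrite !big_cons /= mulrA; apply: IH => // j.
rewrite coefZ (mulrC c) -mulrA -coefZ.
apply: integral_coefM => l; rewrite -scalerAr.
by have := h l; rewrite big_cons.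
Qed.

(** * Galois-invariant integers are rational integers *)

Lemma rat_integral (x : rat) :
  integralOver (intr : int -> rat) x -> exists z : int, x = z%:~R.
Proof.
case=> p mp px0.
have /intrP[z Dz] : ratr x \in (Num.int : {pred algC}).
  apply: Cint_rat_Aint; first exact: Crat_rat.
  apply: (@root_monic_Aint (map_poly intr p)).
  - rewrite -(fmorph_root (ratr : {rmorphism rat -> algC})) in px0.
    move: px0; rewrite -map_poly_comp; congr (root _ _).
    by apply: eq_map_poly => z /=; rewrite rmorph_int.
  - by apply: monic_map.
  - by apply/polyOverP => i; rewrite coef_map /= intr_int.
exists z; apply: (fmorph_inj (ratr : {rmorphism rat -> algC})).
by rewrite /= rmorph_int.
Qed.

Lemma galois_fixed_integral (K : splittingFieldType rat) (x : K) :
  galois 1%AS {:K}%AS -> (forall g : gal_of {:K}%AS, g x = x) ->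
  integralOver (intr : int -> K) x -> exists z : int, x = z%:~R.
Proof.
move=> /galois_fixedField gK xfix xint.
have : x \in fixedField ('Gal({:K}%AS / 1%AS))%g.
  by apply/fixedFieldP => [|g _]; rewrite ?memvf.
rewrite gK => /vlineP[a Dx]; move: xint; rewrite Dx.
move=> /(integralOver_inj (in_alg K))/rat_integral[z ->]; exists z.
by rewrite -[RHS](rmorph_int (in_alg K)).
Qed.

(** * Fixed points of maps of prime-power order *)

(** Such a map is a permutation generating a [q]-group, so its number of fixed points is congruent
    modulo [q] to the cardinal of [A]. *)
Lemma fixed_point_of_qpower_order (T : choiceType) (A : set T) (phi : T -> T)
    (q t : nat) :
  prime q -> (forall x, A x -> A (phi x)) ->
  (forall x, A x -> iter (q ^ t) phi x = x) ->
  ~~ (q %| #|` fset_set A|%fset)%N -> exists2 x, A x & phi x = x.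
Proof.
move=> q_pr Aphi phiq nq.
(* An infinite [A] would have cardinal 0 by the convention on [fset_set], and [q] divides 0. *)
have finA : finite_set A.
  apply: contrapT => infA; move: nq.
  by rewrite /fset_set; case: pselect => // _; rewrite cardfs0 dvdn0.
pose X := fset_set A.
have XA x : (x \in X) = (x \in A) by rewrite in_fset_set.
have Xphi (x : X) : phi (val x) \in X.
  by rewrite XA inE; apply: Aphi; have := valP x; rewrite XA inE.
pose f (x : X) : X := [` Xphi x]%fset.
have fE k x : val (iter k f x) = iter k phi (val x).
  by elim: k => //= k ->.
have fq x : iter (q ^ t) f x = x.
  apply: val_inj; rewrite fE phiq //.
  by have := valP x; rewrite XA inE.
have f_inj : injective f.
  have qt : (q ^ t = (q ^ t).-1.+1)%N by rewrite prednK // expn_gt0 prime_gt0.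
  by move=> x y fxy; rewrite -(fq x) -(fq y) qt !iterSr fxy.
pose s := perm f_inj.
have sX k x : (s ^+ k)%g x = iter k f x.
  by rewrite permX; apply: eq_iter => y; rewrite permE.
have s1 : (s ^+ (q ^ t) = 1)%g.
  by apply/permP => x; rewrite sX fq perm1.
have qs : (q.-group <[s]>)%g.
  apply: (@pnat_dvd _ (q ^ t)); last by rewrite pnatX pnat_id.
  by rewrite order_dvdn s1.
have actsX : [acts <[s]>, on [set: X] | 'P]%g.
  by apply/actsP => a _ x; rewrite !inE.
have := pgroup_fix_mod qs actsX.
have [->|[x]] := set_0Vmem ('Fix_([set: X] | 'P)(<[s]>))%g.
  rewrite cards0 cardsT -cardfE => /eqP; rewrite mod0n => h.
  by move: nq; rewrite /dvdn h.
case/setIP=> _ /afixP/(_ s (cycle_id s)) /= sx _; exists (val x).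
  by have := valP x; rewrite XA inE.
by rewrite -{2}sx /= apermE permE.
Qed.

(** * The Galois action on integers, ideals and ideal classes *)

Section GaloisAction.
Variable K : splittingFieldType rat.
Local Notation O := (ring_of_integers K).
Local Notation gT := (gal_of {:K}%AS).
Implicit Types (g h : gT) (I J : nzideal K).

Lemma gal_algint g (x : O) : g (val x) \in @algint K.
Proof.
apply/asboolP/(integralOver_inj g)/asboolP; exact: (valP x).
Qed.

Definition galO g (x : O) : O := AlgInt (gal_algint g x).

Lemma galO_is_zmod_morphism g : zmod_morphism (galO g).
Proof. by move=> x y; apply: val_inj; rewrite /= !rmorphB. Qed.

Lemma galO_is_monoid_morphism g : monoid_morphism (galO g).
Proof. by split=> [|x y]; apply: val_inj; rewrite /= ?rmorph1 ?rmorphM. Qed.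

HB.instance Definition _ g :=
  GRing.isZmodMorphism.Build O O (galO g) (galO_is_zmod_morphism g).
HB.instance Definition _ g :=
  GRing.isMonoidMorphism.Build O O (galO g) (galO_is_monoid_morphism g).

Lemma galOM g h x : galO (g * h)%g x = galO h (galO g x).
Proof. by apply: val_inj; rewrite /= galM ?memvf. Qed.

Lemma galO1 x : galO 1%g x = x.
Proof. by apply: val_inj; rewrite /= gal_id. Qed.

Lemma galOK g : cancel (galO g) (galO g^-1%g).
Proof. by move=> x; rewrite -galOM mulgV galO1. Qed.

Lemma galOVK g : cancel (galO g^-1%g) (galO g).
Proof. by move=> x; rewrite -galOM mulVg galO1. Qed.

Definition galI g I : nzideal K.
Proof.
refine (@NZIdeal _ [set galO g x | x in (I : set O)]%classic _ _ _ _).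
- by exists 0; [exact: nzideal0 | rewrite rmorph0].
- move=> _ _ [x Ix <-] [y Iy <-].
  by exists (x + y); [exact: nzidealD | rewrite rmorphD].
- move=> a _ [x Ix <-]; exists (galO g^-1%g a * x); first exact: nzidealM.
  by rewrite rmorphM /= galOVK.
- have [x Ix x0] := nzideal_neq0 I; exists (galO g x); first by exists x.
  by rewrite -(rmorph0 (galO g)) (can_eq (galOK g)).
Defined.

Lemma galI1 I : galI 1%g I = I.
Proof.
apply: nzideal_inj; apply/seteqP; split=> [_ [x Ix <-]|x Ix].
  by rewrite galO1.
by exists x => //; rewrite galO1.
Qed.

Lemma galIM g h I : galI (g * h)%g I = galI h (galI g I).
Proof.
apply: nzideal_inj; apply/seteqP; split=> [_ [x Ix <-]|_ [_ [x Ix <-] <-]].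
  by rewrite galOM; exists (galO g x) => //; exists x.
by exists x => //; rewrite galOM.
Qed.

Lemma galI_mul_sub g I J :
  (galI g (I * J)%g `<=` (galI g I * galI g J)%g)%classic.
Proof.
move=> _ [_ [s hs ->] <-]; rewrite rmorph_sum.
apply: (@nzideal_sum _ (galI g I * galI g J)%g) => u /hs[Iu Ju].
by rewrite rmorphM; apply: prod_setM; [exists u.1 | exists u.2].
Qed.

Lemma galI_mul g I J : galI g (I * J)%g = (galI g I * galI g J)%g.
Proof.
apply: nzideal_inj; apply/seteqP; split; first exact: galI_mul_sub.
apply: (@prod_set_sub _ _ _ (galI g (I * J)%g)) => _ _ [x Ix <-] [y Jy <-].
by rewrite -rmorphM; exists (x * y) => //; apply: prod_setM.
Qed.

Lemma galI_equiv g I J :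
  nzideal_equiv I J -> nzideal_equiv (galI g I) (galI g J).
Proof.
have sub (a b : O) (A B : nzideal K) :
    ([set a * x | x in (A : set O)] `<=`
     [set b * x | x in (B : set O)])%classic ->
    ([set galO g a * x | x in (galI g A : set O)] `<=`
     [set galO g b * x | x in (galI g B : set O)])%classic.
  move=> AB _ [_ [x Ax <-] <-].
  have [y By Dy] : [set b * x | x in (B : set O)]%classic (a * x).
    by apply: AB; exists x.
  by exists (galO g y); [exists y | rewrite -!rmorphM Dy].
move=> /nzideal_equivP[a [b [a0 b0 /seteqP[h1 h2]]]].
apply/nzideal_equivP; exists (galO g a), (galO g b).
rewrite -(rmorph0 (galO g)) !(can_eq (galOK g)).
by split=> //; apply/seteqP; split; apply: sub.
Qed.

Definition galC g (c : class_group K) : class_group K :=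
  ideal_class (galI g (generic_quotient.repr c)).

(** Independence of the representative chosen in [galC]. *)
Lemma galC_class g I : galC g (ideal_class I) = ideal_class (galI g I).
Proof.
apply/ideal_classP/galI_equiv/ideal_classP; exact: ideal_class_repr.
Qed.

Lemma galC_mul g : {morph galC g : c d / (c * d)%g}.
Proof.
move=> c d; rewrite -(ideal_class_repr c) -(ideal_class_repr d).
by rewrite -[(_ * _)%g]ideal_classM !galC_class galI_mul ideal_classM.
Qed.

Lemma galC1 c : galC 1%g c = c.
Proof. by rewrite -(ideal_class_repr c) galC_class galI1. Qed.

Lemma galCM g h c : galC (g * h)%g c = galC h (galC g c).
Proof. by rewrite -(ideal_class_repr c) !galC_class galIM. Qed.

Lemma galCX g k c : galC (g ^+ k)%g c = iter k (galC g) c.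
Proof.
elim: k => [|k IH]; first by rewrite expg0 galC1.
by rewrite expgSr galCM IH.
Qed.

Lemma galC_trivial (q t : nat) g :
  prime q -> (g ^+ (q ^ t) = 1)%g -> ~~ (q %| card_class_automorphisms K)%N ->
  galC g =1 id.
Proof.
move=> q_pr gq nq.
have galC_bij : bijective (galC g).
  by exists (galC g^-1%g) => c; rewrite -galCM ?mulgV ?mulVg galC1.
have [s|s _|s [[s' sK s'K] _] ss c] := fixed_point_of_qpower_order
    (A := @class_automorphisms K) (phi := fun s => galC g \o s) (t := t)
    q_pr _ _ nq.
- move=> [s_bij sM]; split; first exact: bij_comp.
  by move=> c d /=; rewrite sM galC_mul.
- apply/funext => c.
  have -> : forall k, iter k (fun s => galC g \o s) s c = iter k (galC g) (s c).
    by elim=> //= k ->.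
  by rewrite -galCX gq galC1.
(* Evaluating the fixed-point equation at [s' c] cancels the automorphism [s]. *)
by have /(congr1 (fun f => f (s' c))) /= := ss; rewrite s'K.
Qed.

(** * Norm ideals are principal *)

Definition norm_ideal I : nzideal K :=
  (\prod_(g <- enum [set: gT]) galI g I)%g.

Lemma prod_galI_coef (s : seq gT) I (f : {poly O}) :
  (forall k, nzideal_set I f`_k) ->
  forall k, nzideal_set (\prod_(g <- s) galI g I)%g
    (\prod_(g <- s) map_poly (galO g) f)`_k.
Proof.
move=> If; elim: s => [|g s IH] k; first by rewrite !big_nil.
rewrite !big_cons coefM; apply: nzideal_sum => i _; apply: prod_setM => //.
by rewrite coef_map; exists f`_i.
Qed.

(** Products of conjugates of elements of [I] generate the product ideal additively, so integrality
    is tested on them alone. The induction absorbs each conjugate into [c], which starts as the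
    inverse of an integer in the application. *)
Lemma prod_galI_integral (s : seq gT) I (c : K) :
  (forall xs : seq O, size xs = size s ->
    (forall x, x \in xs -> nzideal_set I x) ->
    c * \prod_(u <- zip s xs) u.1 (val u.2) \in @algint K) ->
  forall y : O, nzideal_set (\prod_(g <- s) galI g I)%g y ->
    c * val y \in @algint K.
Proof.
elim: s c => [|g s IH] c h y.
  move=> _; apply: rpredM; last exact: valP.
  by have := h [::] erefl; rewrite big_nil mulr1; apply.
rewrite big_cons => -[r hr ->]; rewrite rmorph_sum mulr_sumr big_seq.
apply: rpred_sum => u /hr[[x Ix <-] sy]; rewrite rmorphM mulrA.
apply: IH sy => xs sxs xsI.
have := h (x :: xs); rewrite /= sxs big_cons /= mulrA; apply=> // z.
by rewrite inE => /predU1P[->|/xsI].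
Qed.

(** Up to sign the content is the gcd of the coefficients, which by Bezout is a combination of
    them. *)
Lemma zcontents_in_ideal I (p : {poly int}) :
  (forall k, nzideal_set I (p`_k)%:~R) -> nzideal_set I (zcontents p)%:~R.
Proof.
move=> Ip; rewrite /zcontents intrM; apply: nzidealM.
have absI (z : int) : nzideal_set I z%:~R -> nzideal_set I (`|z|%N : int)%:~R.
  by move=> Iz; rewrite abszEsg intrM; apply: nzidealM.
apply: (big_ind (fun n : nat => nzideal_set I (n : int)%:~R)).
- by rewrite mulr0z; exact: nzideal0.
- move=> m n Im In; have [u [v]] := Bezoutz m n.
  rewrite /gcdz !absz_nat => <-; rewrite rmorphD !rmorphM.
  by apply: nzidealD; apply: nzidealM.
- by move=> i _; apply: absI.
Qed.

Hypothesis galK : galois 1%AS {:K}%AS.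

(** The Galois group permutes the factors, so the product has coefficients in the integers; [z] is
    its content and [p] its primitive part. *)
Lemma norm_poly_content I (f : {poly O}) : (forall k, nzideal_set I f`_k) ->
  exists (z : int) (p : {poly O}), nzideal_set (norm_ideal I) z%:~R /\
    \prod_(g <- enum [set: gT]) map_poly (galO g) f = z%:~R *: p.
Proof.
move=> If; set P := \prod_(g <- _) _.
have P_fix h : map_poly (galO h) P = P.
  rewrite /P !big_enum rmorph_prod [RHS](reindex_inj (mulIg h)) /=.
  apply: eq_big => [g|g _]; first by rewrite !inE.
  by rewrite -map_poly_comp; apply: eq_map_poly => x; rewrite /= galOM.
have P_int k : exists z : int, P`_k = z%:~R.
  have [||z Dz] := galois_fixed_integral (x := val P`_k) galK.
  - move=> h; have /(congr1 (fun p : {poly O} => val p`_k)) := P_fix h.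
    by rewrite coef_map.
  - by apply/asboolP; exact: (valP P`_k).
  by exists z; apply: val_inj; rewrite rmorph_int.
have [c Dc] := choice P_int.
have DP : P = map_poly intr (\poly_(k < size P) c k).
  apply/polyP => k; rewrite coef_map coef_poly; case: ltnP => // hk.
  by rewrite nth_default.
move: DP; set p := \poly_(k < _) _ => DP.
exists (zcontents p), (map_poly intr (zprimitive p)); split.
  apply: zcontents_in_ideal => k; rewrite -coef_map -DP.
  exact: prod_galI_coef.
by rewrite {1}DP {1}(zpolyEprim p) map_polyZ.
Qed.

(* n is the least positive integer in the norm ideal; it divides the content of
   every norm polynomial. *)
Lemma norm_ideal_principal I : exists2 n : nat, n != 0%N &
  norm_ideal I = [set n%:R * x | x in setT]%classic :> set O.
Proof.
pose inN (n : nat) := (0 < n)%N && `[< nzideal_set (norm_ideal I) n%:R >].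
have abs_in (z : int) :
    z != 0 -> nzideal_set (norm_ideal I) z%:~R -> inN `|z|%N.
  move=> z0 Nz; rewrite /inN absz_gt0 z0 /=; apply/asboolP.
  rewrite -[_%:R]/((`|z|%N : int)%:~R) abszEsg intrM; exact: nzidealM.
have exN : exists n, inN n.
  have [x Ix x0] := nzideal_neq0 I.
  (* For the constant polynomial [x] the norm polynomial is the product of the conjugates of [x]; it
     is nonzero, hence so is [z]. *)
  have [k|z [p [Nz Dz]]] := @norm_poly_content I x%:P.
    by rewrite coefC; case: ifP => // _; exact: nzideal0.
  exists `|z|%N; apply: abs_in => //; apply: contra_eq_neq Dz => ->.
  rewrite scale0r (eq_bigr (fun g => (galO g x)%:P)); last first.
    by move=> g _; rewrite map_polyC.
  rewrite -rmorph_prod polyC_eq0; elim: (enum _) => [|g s IH].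
    by rewrite big_nil oner_neq0.
  rewrite big_cons; apply: ring_of_integers_mulf_neq0 => //.
  by rewrite -(rmorph0 (galO g)) (can_eq (galOK g)).
case: (ex_minnP exN) => n /andP[n_gt0 /asboolP Nn] n_min.
(* A nonzero remainder modulo [n] would be a smaller positive integer in the norm ideal. *)
have n_dvd (z : int) : nzideal_set (norm_ideal I) z%:~R -> (n %| z)%Z.
  move=> Nz; apply/dvdz_mod0P/eqP; apply: contraT => r0.
  have := n_min `|(z %% n)%Z|%N; rewrite abs_in //.
    move=> /(_ isT); rewrite leqNgt -ltz_nat gez0_abs ?modz_ge0 ?ltz_pmod //.
    by rewrite eqz_nat -lt0n.
  rewrite /modz rmorphB rmorphM /= -mulNr -rmorphN /=.
  apply: nzidealD => //; apply: nzidealM; exact: Nn.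
exists n; first by rewrite -lt0n.
apply/seteqP; split=> [y Ny|_ [x _ <-]]; last first.
  by rewrite mulrC; apply: nzidealM.
have nK : n%:R != 0 :> K.
  by rewrite -(rmorph_nat (in_alg K)) fmorph_eq0 pnatr_eq0 -lt0n.
suff yint : n%:R^-1 * val y \in @algint K.
  exists (AlgInt yint) => //; apply: val_inj.
  by rewrite rmorphM rmorph_nat /= mulVKf.
apply: prod_galI_integral Ny => xs sxs xsI.
(* A single polynomial carries all entries of [xs]: a product of conjugates of these entries is then
   a product of coefficients, one from each conjugate of [f], at indices 0, 1, 2 and so on. *)
pose f : {poly O} := Poly xs.
have If k : nzideal_set I f`_k.
  rewrite coef_Poly; have [hk|hk] := ltnP k (size xs).
    by apply/xsI/mem_nth.
  by rewrite nth_default //; exact: nzideal0.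
have [z [p [/n_dvd/dvdzP[d ->] Dz]]] := norm_poly_content If.
have := @integral_coef_prod K _ (enum [set: gT])
  (fun g => map_poly val (map_poly (galO g) f)) (iota 0 (size xs)) n%:R^-1.
rewrite size_iota => /(_ sxs) h; apply/asboolP.
have Dxs : xs = [seq f`_i | i <- iota 0 (size xs)].
  by rewrite -[LHS](mkseq_nth 0); apply: eq_map => i; rewrite coef_Poly.
have -> : zip (enum [set: gT]) xs =
    [seq (u.1, f`_u.2) | u <- zip (enum [set: gT]) (iota 0 (size xs))].
  rewrite {1}Dxs; elim: (enum _) (iota _ _) => [|g s IH] [|i x] //=.
  by rewrite IH.
rewrite big_map /= (eq_bigr (fun u =>
  (map_poly val (map_poly (galO u.1) f))`_u.2)) => [|u _]; last first.
  by rewrite !coef_map.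
(* The content has been written as [d * n], so dividing the norm polynomial by [n] leaves [d] times
   [p], with integral coefficients. *)
apply: h => k; rewrite -rmorph_prod Dz.
rewrite coefZ [X in _ * X](_ : _ = n%:R * (d%:~R * val p`_k)); last first.
  rewrite coef_map coefZ mulrCA mulrA.
  have <- : val ((d * n)%:~R : O) = d%:~R * n%:R by rewrite rmorph_int intrM.
  by rewrite -rmorphM.
rewrite mulKf //; suff /asboolP : d%:~R * val p`_k \in @algint K by [].
by apply: rpredM; [exact: rpred_int | exact: (valP p`_k)].
Qed.

Lemma norm_ideal_class I : ideal_class (norm_ideal I) = 1%g.
Proof.
have [n n0 DN] := norm_ideal_principal I.
apply/ideal_classP/nzideal_equivP; exists 1, n%:R; split.
- exact: oner_neq0.
- apply: contra_neq n0 => /(congr1 val); rewrite rmorph_nat rmorph0 /= => /eqP.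
  by rewrite -(rmorph_nat (in_alg K)) fmorph_eq0 pnatr_eq0 => /eqP.
- rewrite -DN; apply/seteqP; split=> [_ [x Nx <-]|x Nx]; first by rewrite mul1r.
  by exists x; rewrite ?mul1r.
Qed.

(** * Triviality of the class group *)

(** Under a trivial action every factor of the norm ideal has class [c], while the norm ideal itself
    is principal. *)
Lemma class_expn_degree (c : class_group K) :
  (forall g, galC g =1 id) -> (c ^+ #|[set: gT]| = 1)%g.
Proof.
move=> galC_id; rewrite -(norm_ideal_class (generic_quotient.repr c)).
rewrite /norm_ideal (big_morph _ (@ideal_classM K) (erefl _)) cardE.
elim: (enum _) => [|g s IH]; first by rewrite big_nil expg0.
by rewrite big_cons expgS IH -galC_class ideal_class_repr galC_id.
Qed.

(** Every element of [gT] fixes the rationals, so the Galois group over [1%AS] is the whole type. *)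
Lemma card_gal : #|[set: gT]| = \dim {:K}%AS.
Proof.
have := galois_dim galK; rewrite dimv1 divn1 => ->; apply: eq_card.
by move=> g; rewrite inE gal_kHom ?sub1v // k1HomE ahomWin.
Qed.

Lemma class_group_trivial (q t : nat) : prime q -> \dim {:K}%AS = (q ^ t)%N ->
  ~~ (q %| card_class_automorphisms K)%N -> ~~ (q %| class_number K)%N ->
  forall c : class_group K, c = 1%g.
Proof.
move=> q_pr dimK nqA nqC c.
have gq g : (g ^+ (q ^ t) = 1)%g.
  by rewrite -dimK -card_gal expg_cardG ?inE.
have cq (d : class_group K) : (d ^+ (q ^ t) = 1)%g.
  rewrite -dimK -card_gal; apply: class_expn_degree => g.
  exact: galC_trivial q_pr (gq g) nqA.
have qt : (q ^ t = (q ^ t).-1.+1)%N by rewrite prednK // expn_gt0 prime_gt0.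
have iterM k d : iter k (fun d => c * d)%g d = (c ^+ k * d)%g.
  by elim: k => [|k IH]; rewrite ?expg0 ?mul1g //= IH mulgA -expgS.
have [//|d _|d _ cd] := fixed_point_of_qpower_order
    (A := [set: class_group K]%classic) (phi := fun d => (c * d)%g) (t := t)
    q_pr _ _ nqC.
  by rewrite iterM cq mul1g.
(* The fixed point gives [c * d = d]; multiplying by the power of [d] of exponent [(q ^ t).-1],
   which is inverse to [d], yields [c = 1]. *)
by rewrite -[c]mulg1 -(cq d) qt expgS mulgA cd.
Qed.

End GaloisAction.

Local Close Scope ring_scope.

Theorem theorem4p2 (K : splittingFieldType rat) (q t : nat)
    (u : nat) (p e : 'I_u -> nat) :
  prime q -> odd q -> 1 < t ->
  galois 1%AS {:K}%AS -> \dim {:K}%AS = q ^ t ->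
  (forall i, prime (p i)) -> injective p ->
  class_number K = \prod_(i < u) p i ^ e i ->
  ~~ (q %| card_class_automorphisms K) ->
  coprime q (class_number K) ->
  generating_residue_degrees K q.
Proof.
move=> q_pr _ _ galK dimK _ _ _ nqA; rewrite prime_coprime // => nqC.
split; first exact: prime_gt0.
(* The only class is 1, and [H] contains it. *)
move=> H [H1 _ _] _; apply/seteqP; split=> // c _.
by rewrite (class_group_trivial galK q_pr dimK nqA nqC c).
Qed.
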